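(* Let $\beta$, $\rho_\pm>0$, $u_\pm\ge0$ be constants. As the pressure vanishes ($A\to0$), the Riemann solutions (given in the context) to the Chaplygin pressure Aw–Rascle model with Coulomb-like friction $$\rho_t+(\rho u)_x=0,\qquad (\rho(u+P))_t+(\rho u(u+P))_x=\beta\rho,\qquad P=-\frac{A}{\rho},\ A>0,$$ with initial data $(\rho,u)(x,0)=(\rho_-,u_-)$ for $x<0$ and $(\rho,u)(x,0)=(\rho_+,u_+)$ for $x>0$, tend to the three kinds of Riemann solutions (given in the context, for $u_-<u_+$, $u_-=u_+$ and $u_->u_+$ respectively) to the transportation equations with the same source term $$\rho_t+(\rho u)_x=0,\qquad (\rho u)_t+(\rho u^2)_x=\beta\rho$$ and the same initial data, which include a delta shock wave and a vacuum state.
   Context: Riemann solution of the model with $A>0$. (i) If $u_+>u_--\frac{A}{\rho_-}$: $(\rho,u)(x,t)=(\rho_-,u_-+\beta t)$ for $x<x_1(t)$, $(\rho_*,v_*+\beta t)$ for $x_1(t)<x<x_2(t)$, and $(\rho_+,u_++\beta t)$ for $x>x_2(t)$, where $v_*=u_+$, $\frac{A}{\rho_*}=u_+-u_-+\frac{A}{\rho_-}$, $x_1(t)=\big(u_--\frac{A}{\rho_-}\big)t+\frac12\beta t^2$ and $x_2(t)=u_+t+\frac12\beta t^2$. (When $u_+=u_-$ one has $\rho_*=\rho_-$ and only the discontinuity at $x_2(t)$ remains.) (ii) If $u_+\le u_--\frac{A}{\rho_-}$: the delta shock wave solution $$(\rho,u)(x,t)=\begin{cases}(\rho_-,u_-+\beta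 t), & x<x(t),\\ (w(t)\delta(x-x(t)),\,u_\delta(t)), & x=x(t),\\ (\rho_+,u_++\beta t), & x>x(t),\end{cases}$$ with $u_\delta(t)=x'(t)=v_\delta+\beta t$, $x(t)=v_\delta t+\frac12\beta t^2$, $w(t)=w_0t$. Here $\rho$ carries on the curve $x=x(t)$ a Dirac measure of weight $w(t)$, acting on test functions $\psi$ by $\int_0^\infty w(t)\psi(x(t),t)\,dt$, and $u_\delta(t)$ is the value assigned to $u$ on that curve. If $\rho_+\ne\rho_-$, $$w_0=\sqrt{\rho_+\rho_-(u_+-u_-)\Big((u_+-u_-)-\Big(\frac{A}{\rho_+}-\frac{A}{\rho_-}\Big)\Big)},\qquad v_\delta=\frac{\rho_+u_+-\rho_-u_-+w_0}{\rho_+-\rho_-};$$ if $\rho_+=\rho_-$, $v_\delta=\frac12\big(u_++u_--\frac{A}{\rho_-}\big)$ and $w_0=\rho_-u_--\rho_+u_+$. Riemann solutions of the transportation equations with source term $\beta\rho$. (a) $u_-<u_+$: $(\rho_-,u_-+\beta t)$ for $x<u_-t+\frac12\beta t^2$; vacuum for $u_-t+\frac12\beta t^2<x<u_+t+\frac12\beta t^2$; $(\rho_+,u_++\beta t)$ for $x>u_+t+\frac12\beta t^2$. (b) $u_-=u_+$: $(\rho_-,u_-+\beta t)$ for $x<u_-t+\frac12\beta t^2$; $(\rho_+,u_++\beta t)$ for $x>u_+t+\frac12\beta t^2$. (c) $u_->u_+$: a delta shock wave of the same form as in (ii), with $u_\delta(t)=v_\delta+\beta t$, $x(t)=v_\delta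 t+\frac12\beta t^2$, $w(t)=w_0t$, where for $\rho_+\neq\rho_-$ one has $v_\delta=\frac{\sqrt{\rho_-}\,u_-+\sqrt{\rho_+}\,u_+}{\sqrt{\rho_-}+\sqrt{\rho_+}}$ and $w_0=\sqrt{\rho_+\rho_-}\,(u_--u_+)$, and for $\rho_+=\rho_-$ one has $v_\delta=\frac12(u_++u_-)$ and $w_0=\rho_+(u_--u_+)$. *)

(* Defs.v *)
From HB Require Import structures.
From mathcomp Require Import all_boot all_order all_algebra.
From mathcomp Require Import all_classical all_reals all_analysis.
Set Implicit Arguments.
Unset Strict Implicit.
Unset Printing Implicit Defensive.
Import Order.TTheory GRing.Theory Num.Theory.
Import numFieldNormedType.Exports.
Local Open Scope classical_set_scope.
Local Open Scope ring_scope.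

(* [DeltaShock w u]: the density carries a Dirac mass of weight [w], moving with
   velocity [u]. The velocity of a vacuum is undefined. *)
Variant state (R : realType) :=
  | Vacuum
  | Fluid of R & R
  | DeltaShock of R & R.

Arguments Vacuum {R}.

Definition density (R : realType) (s : state R) : R :=
  if s is Fluid rho _ then rho else 0.

Definition momentum (R : realType) (s : state R) : R :=
  if s is Fluid rho u then rho * u else 0.

Definition dirac_density (R : realType) (s : state R) : R :=
  if s is DeltaShock w _ then w else 0.

Definition dirac_momentum (R : realType) (s : state R) : R :=
  if s is DeltaShock w u then w * u else 0.

(* Three states, as functions of time, separated by the two curves
   [x = left_front t] and [x = right_front t]. When the curves coincide the
   middle state lives on the curve only: this is how a delta shock wave (middle
   state [DeltaShock]) and a single contact discontinuity are encoded. *)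
Record riemann_solution (R : realType) := RiemannSolution {
  left_front : R -> R ;
  right_front : R -> R ;
  left_state : R -> state R ;
  middle_state : R -> state R ;
  right_state : R -> state R }.

Definition state_at (R : realType) (S : riemann_solution R) (x t : R) : state R :=
  if x < left_front S t then left_state S t
  else if right_front S t < x then right_state S t
  else middle_state S t.

Section Solutions.
Context {R : realType}.
Variables beta rhom um rhop up : R.

Definition char_curve (v t : R) : R := v * t + beta * t ^+ 2 / 2.

Definition fluid_state (rho v t : R) : state R := Fluid rho (v + beta * t).

Definition delta_wave (v w0 : R) : riemann_solution R :=
  RiemannSolution (char_curve v) (char_curve v)
    (fluid_state rhom um)
    (fun t => DeltaShock (w0 * t) (v + beta * t))
    (fluid_state rhop up).

(* Riemann solution of
     rho_t + (rho u)_x = 0,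
     (rho (u + P))_t + (rho u (u + P))_x = beta rho,   P = - A / rho. *)

Definition rho_star (A : R) : R := A / (up - um + A / rhom).

Definition chaplygin_w0 (A : R) : R :=
  if rhop == rhom then rhom * um - rhop * up
  else Num.sqrt (rhop * rhom * (up - um) *
                 ((up - um) - (A / rhop - A / rhom))).

Definition chaplygin_vdelta (A : R) : R :=
  if rhop == rhom then (up + um - A / rhom) / 2
  else (rhop * up - rhom * um + chaplygin_w0 A) / (rhop - rhom).

Definition chaplygin_solution (A : R) : riemann_solution R :=
  if um - A / rhom < up then
    RiemannSolution (char_curve (um - A / rhom)) (char_curve up)
      (fluid_state rhom um)
      (fluid_state (rho_star A) up)
      (fluid_state rhop up)
  else delta_wave (chaplygin_vdelta A) (chaplygin_w0 A).

(* Riemann solution of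
     rho_t + (rho u)_x = 0,   (rho u)_t + (rho u^2)_x = beta rho. *)

Definition transport_w0 : R :=
  if rhop == rhom then rhop * (um - up)
  else Num.sqrt (rhop * rhom) * (um - up).

Definition transport_vdelta : R :=
  if rhop == rhom then (up + um) / 2
  else (Num.sqrt rhom * um + Num.sqrt rhop * up) /
       (Num.sqrt rhom + Num.sqrt rhop).

(* For [um = up] the region between the fronts is empty: the middle state is only
   the (immaterial) value on the contact discontinuity, taken from the left. *)
Definition transport_solution : riemann_solution R :=
  if um < up then
    RiemannSolution (char_curve um) (char_curve up)
      (fluid_state rhom um) (fun=> Vacuum) (fluid_state rhop up)
  else if um == up then
    RiemannSolution (char_curve um) (char_curve up)
      (fluid_state rhom um) (fluid_state rhom um) (fluid_state rhop up)
  else delta_wave transport_vdelta transport_w0.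

End Solutions.

Definition half_plane_action (R : realType) (ac sing : state R -> R)
    (S : riemann_solution R) (psi : R * R -> R) : R :=
  \int[lebesgue_measure]_(t in `[0, +oo[)
    (\int[lebesgue_measure]_(x in [set: R]) (ac (state_at S x t) * psi (x, t)))
  + \int[lebesgue_measure]_(t in `[0, +oo[)
      (sing (middle_state S t) * psi (left_front S t, t)).

(* The measures [rho] and [rho u] on the half plane [t >= 0]; the singular part
   sits on [x = left_front t], which for a delta shock is also the right front. *)
Definition density_action (R : realType) :=
  half_plane_action (@density R) (@dirac_density R).

Definition momentum_action (R : realType) :=
  half_plane_action (@momentum R) (@dirac_momentum R).

(* Restricting these to [t >= 0] gives all of C_c(R x [0, +oo)). *)
Definition test_function (R : realType) (psi : R * R -> R) : Prop :=
  continuous psi /\ compact (closure [set p | psi p != 0]).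

(* Convergence as the parameter [A] decreases to 0. No velocity is prescribed in
   a vacuum, so there only the density is required to converge. *)
Definition state_cvg (R : realType) (s : R -> state R) (s0 : state R) : Prop :=
  match s0 with
  | Vacuum =>
      (\forall A \near 0^'+, forall w u, s A <> DeltaShock w u) /\
      density (s A) @[A --> 0^'+] --> 0
  | Fluid rho0 u0 => exists rho u : R -> R,
      [/\ \forall A \near 0^'+, s A = Fluid (rho A) (u A),
          rho A @[A --> 0^'+] --> rho0
        & u A @[A --> 0^'+] --> u0]
  | DeltaShock w0 u0 => exists w u : R -> R,
      [/\ \forall A \near 0^'+, s A = DeltaShock (w A) (u A),
          w A @[A --> 0^'+] --> w0
        & u A @[A --> 0^'+] --> u0]
  end.

(* The waves converge (positions of the fronts and state between them), the
   solutions converge pointwise off the limit fronts, and [rho] and [rho u]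
   converge as measures on the closed half plane. *)
Definition riemann_cvg (R : realType)
    (S : R -> riemann_solution R) (S0 : riemann_solution R) : Prop :=
  [/\ forall t, 0 <= t ->
        [/\ left_front (S A) t @[A --> 0^'+] --> left_front S0 t,
            right_front (S A) t @[A --> 0^'+] --> right_front S0 t
          & state_cvg (fun A => middle_state (S A) t) (middle_state S0 t)],
      forall x t, 0 <= t -> x != left_front S0 t -> x != right_front S0 t ->
        state_cvg (fun A => state_at (S A) x t) (state_at S0 x t)
    & forall psi, test_function psi ->
        density_action (S A) psi @[A --> 0^'+] --> density_action S0 psi /\
        momentum_action (S A) psi @[A --> 0^'+] --> momentum_action S0 psi].

(* Main.v *)
Require Import Defs.
From mathcomp Require Import all_boot all_order all_algebra.
From mathcomp Require Import all_classical all_reals all_analysis.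
From mathcomp Require Import measurable_realfun.
From mathcomp Require Import ring lra.
Import Order.TTheory GRing.Theory Num.Theory.
Import numFieldNormedType.Exports.
Local Open Scope classical_set_scope.
Local Open Scope ring_scope.

Set Implicit Arguments.
Unset Strict Implicit.
Unset Printing Implicit Defensive.

(** Every solution in play consists of the same two outer states and of a middle
    state between two curves [char_curve beta a] and [char_curve beta b]
    ([two_front_wave]; the curves of a delta shock coincide), so convergence of
    such waves reduces to convergence of the speeds [a] and [b] and of the middle state ([two_front_wave_cvg]). Off
    the limit fronts this is clear, because a point strictly on one side of a
    limit front is eventually on the same side of the approximating one.

    For the measures [rho] and [rho u], a test function is supported in a compact
    box, on which all the states are bounded uniformly in [A]. Dominated
    convergence, in [x] for fixed [t] and then in [t], therefore turns pointwise
    convergence off the fronts into convergence of the actions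
    ([half_plane_action_cvg]); the two front points of each line [t = const] are
    negligible. The singular parts converge together with their weights, because
    a limit delta shock is already a delta shock for small [A > 0]: no mass has to
    concentrate in the limit.

    It remains to compute the limits of the parameters when [A] decreases to 0.
    - If [um < up], the condition [um - A / rhom < up] always holds, and
      [rho_star = A / (up - um + A / rhom)] tends to 0: the middle state becomes
      a vacuum, and its momentum vanishes as well because its velocity does not
      depend on [A].
    - If [um = up], then [rho_star = rhom] for every [A > 0], and only the left
      front depends on [A]: it merges with the right one.
    - If [up < um], then [up <= um - A / rhom] for small [A], so that the
      solution is a delta shock. If [rhop <> rhom], its weight [w0] is the square
      root of a quantity that tends to [rhop * rhom * (up - um) ^ 2], whence its
      limit. With [m ^ 2 = rhom] and [p ^ 2 = rhop], the limit of [v_delta] is the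
      transport value because
      [p^2 up - m^2 um + p m (um - up) = (p - m) (m um + p up)]. *)

(** * Measurability and dominated convergence *)

Section measurability.
Context {R : realType}.

(** The boxes with rational corners form a countable base of the plane. *)
Lemma open_measurable_prod (U : set (R * R)) :
  open U -> measurable (U : set (measurableTypeR R * measurableTypeR R)).
Proof.
move=> oU.
pose box (q : (rat * rat) * (rat * rat)) : set (R * R) :=
  `]ratr q.1.1, ratr q.1.2[ `*` `]ratr q.2.1, ratr q.2.2[.
pose B q := if pselect (box q `<=` U) then box q else set0.
have -> : U = \bigcup_q B q.
  apply/seteqP; split=> [[x y] Uxy|p [q _]]; last first.
    by rewrite /B; case: pselect => // bU /bU.
  have /nbhs_ballP[e /= e0 eU] := open_nbhs_nbhs (conj oU Uxy).
  have rat_near (z : R) : exists a b : rat,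
      [/\ z - e < ratr a, ratr a < z, z < ratr b & ratr b < z + e].
    have [a ha] : exists a : rat, ratr a \in `]z - e, z[.
      by apply: rat_in_itvoo; rewrite ltrBlDr ltrDl.
    have [b hb] : exists b : rat, ratr b \in `]z, z + e[.
      by apply: rat_in_itvoo; rewrite ltrDl.
    move: ha hb; rewrite !in_itv/= => /andP[a1 a2] /andP[b1 b2].
    by exists a, b.
  have [a [b [a1 a2 b1 b2]]] := rat_near x.
  have [c [d [c1 c2 d1 d2]]] := rat_near y.
  have bU : box ((a, b), (c, d)) `<=` U.
    move=> [x' y']; rewrite /box /= !in_itv/= => -[/andP[h1 h2] /andP[h3 h4]].
    apply: eU; split; rewrite /= /ball/= ltr_norml.
      by apply/andP; split; lra.
    by apply/andP; split; lra.
  exists ((a, b), (c, d)) => //; rewrite /B; case: pselect => //= _.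
  by rewrite /box/= !in_itv/= a2 b1 c2 d1.
apply: countable_bigcupT_measurable => [|q].
  exact: countableP.
rewrite /B; case: pselect => //= _.
by apply: measurableX; exact: measurable_itv.
Qed.

Lemma continuous_prod_measurable (f : R * R -> R) :
  continuous f ->
  measurable_fun setT (f : measurableTypeR R * measurableTypeR R -> R).
Proof.
move=> /continuousP cf.
apply: (measurability _ (RGenOpens.measurableE R)) => _ [_ [a [b ->] <-]].
rewrite setTI; apply: open_measurable_prod; apply: cf; exact: interval_open.
Qed.

End measurability.

Lemma Rintegral_dominated_cvg d (T : measurableType d) (R : realType)
    (mu : {measure set T -> \bar R}) (D : set T) (f : nat -> T -> R)
    (f0 g : T -> R) :
  measurable D -> (forall n, measurable_fun D (f n)) -> measurable_fun D f0 ->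
  {ae mu, forall x, D x -> f n x @[n --> \oo] --> f0 x} ->
  mu.-integrable D (EFin \o g) ->
  (forall n x, D x -> `|f n x| <= g x) ->
  \int[mu]_(x in D) f n x @[n --> \oo] --> \int[mu]_(x in D) f0 x.
Proof.
move=> mD mf mf0 ff0 ig fg.
have mEf n : measurable_fun D (EFin \o f n) by exact/measurable_EFinP.
have mEf0 : measurable_fun D (EFin \o f0) by exact/measurable_EFinP.
have [||i0 _ cv] := dominated_convergence mD mEf mEf0 _ ig.
- by apply: filterS ff0 => x h Dx; apply: cvg_EFin; [exact: nearW|exact: h].
- by apply: aeW => x n Dx; rewrite lee_fin; exact: fg.
apply: (@fine_cvg _ nat); rewrite fineK//; exact: integrable_fin_num.
Qed.

(** Reduces to the Tonelli version by splitting the integrand into its positive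
    and negative parts. *)
Lemma measurable_Rintegral_section d1 d2 (T1 : measurableType d1)
    (T2 : measurableType d2) (R : realType)
    (mu : {sigma_finite_measure set T1 -> \bar R}) (f : T1 * T2 -> R) :
  measurable_fun setT f ->
  measurable_fun setT (fun y => \int[mu]_x f (x, y)).
Proof.
move=> mf; apply: measurableT_comp => //.
under eq_fun do rewrite integralE.
have mEf : measurable_fun setT (EFin \o f) by exact/measurable_EFinP.
have fpos_ge0 z : (0 <= (EFin \o f)^\+ z)%E by exact: funepos_ge0.
have fneg_ge0 z : (0 <= (EFin \o f)^\- z)%E by exact: funeneg_ge0.
apply: emeasurable_funB.
  rewrite [X in measurable_fun _ X](_ : _ = fubini_G mu (EFin \o f)^\+%E).
    by apply: measurable_fun_fubini_tonelli_G; first exact: measurable_funepos.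
  by apply/funext => y; apply: eq_integral => x _; rewrite !funeposE.
rewrite [X in measurable_fun _ X](_ : _ = fubini_G mu (EFin \o f)^\-%E).
  by apply: measurable_fun_fubini_tonelli_G; first exact: measurable_funeneg.
by apply/funext => y; apply: eq_integral => x _; rewrite !funenegE.
Qed.

(** * Convergence of the actions on the half plane *)

Section locally_bounded_convergence.
Context {R : realType}.

(** What dominated convergence asks of the time-dependent coefficients. The bound
    holds for all indices, not only eventually, as it does for the constant
    coefficients because a convergent sequence is bounded. *)
Definition locally_bounded_cvg (f : nat -> R -> R) (f0 : R -> R) : Prop :=
  [/\ forall n, measurable_fun setT (f n),
      measurable_fun setT f0,
      forall t, 0 <= t -> f n t @[n --> \oo] --> f0 t
    & forall T, exists C, forall n t, 0 <= t <= T -> `|f n t| <= C].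

Lemma locally_bounded_cvg_cst (c : nat -> R) (c0 : R) :
  c n @[n --> \oo] --> c0 -> locally_bounded_cvg (fun n _ => c n) (fun=> c0).
Proof.
move=> cc; split=> // T.
have [C [_ Cc]] := cvg_seq_bounded (cvgP _ cc).
exists (C + 1) => n t _; apply: (Cc (C + 1)) => //; by rewrite ltrDl.
Qed.

Lemma locally_bounded_cvg_id : locally_bounded_cvg (fun _ t => t) id.
Proof.
split=> [n||t _|T]; [exact: measurable_id|exact: measurable_id|exact: cvg_cst|].
by exists T => n t /andP[t0 tT]; rewrite ger0_norm.
Qed.

Lemma locally_bounded_cvgD f f0 g g0 :
  locally_bounded_cvg f f0 -> locally_bounded_cvg g g0 ->
  locally_bounded_cvg (fun n t => f n t + g n t) (fun t => f0 t + g0 t).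
Proof.
move=> [mf mf0 cf bf] [mg mg0 cg bg]; split=> [n||t t0|T].
- exact: measurable_funD.
- exact: measurable_funD.
- by apply: cvgD; [exact: cf|exact: cg].
have [[C fC] [D gD]] := (bf T, bg T); exists (C + D) => n t tT.
by rewrite (le_trans (ler_normD _ _))// lerD ?fC ?gD.
Qed.

Lemma locally_bounded_cvgM f f0 g g0 :
  locally_bounded_cvg f f0 -> locally_bounded_cvg g g0 ->
  locally_bounded_cvg (fun n t => f n t * g n t) (fun t => f0 t * g0 t).
Proof.
move=> [mf mf0 cf bf] [mg mg0 cg bg]; split=> [n||t t0|T].
- exact: measurable_funM.
- exact: measurable_funM.
- by apply: cvgM; [exact: cf|exact: cg].
have [[C fC] [D gD]] := (bf T, bg T); exists (C * D) => n t tT.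
by rewrite normrM ler_pM ?fC ?gD.
Qed.

End locally_bounded_convergence.

(** The window is a square, so that one function of one variable dominates both
    the inner integral in [x] and the outer one in [t]. *)
Lemma test_function_dominated (R : realType) (psi : R * R -> R) :
  test_function psi -> exists K M : R, 0 <= M /\
    forall x t, `|psi (x, t)| <= M * (\1_`[- K, K] x * \1_`[- K, K] t).
Proof.
move=> [cpsi ksupp]; set S := closure _ in ksupp.
have [K0 [_ SK]] := compact_bounded ksupp.
have /compact_bounded[M0 [_ SM]] : compact (psi @` S).
  by apply: continuous_compact => //; exact: continuous_subspaceT.
exists (`|K0| + 1), (`|M0| + 1); split=> [|x t]; first by rewrite addr_ge0.
have [->|psi0] := eqVneq (psi (x, t)) 0.
  by rewrite normr0 !mulr_ge0 ?addr_ge0// indicE.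
have Sxt : S (x, t) by apply: subset_closure.
have : `|(x, t)| <= `|K0| + 1.
  by apply: SK => //; rewrite (le_lt_trans (ler_norm _))// ltrDl.
rewrite prod_normE/= ge_max => /andP[xK tK].
rewrite !indicE !mem_setE !in_itv/= -!ler_norml xK tK !mulr1.
apply: SM; last by exists (x, t).
by rewrite (le_lt_trans (ler_norm _))// ltrDl.
Qed.

Lemma ae_off_two_points (R : realType) (a b : R) :
  {ae lebesgue_measure, forall x, x != a /\ x != b}.
Proof.
exists [set a; b]; split=> [||x /= xab].
- by apply: measurableU; exact: measurable_set1.
- by apply: countable_lebesgue_measure0; exact: finite_set_countable.
by apply: contrapT => /not_orP[xa xb]; apply: xab; split; apply/eqP.
Qed.

Section half_plane.
Context {R : realType}.
Variables (ac sing : state R -> R).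
Variables (S : nat -> riemann_solution R) (S0 : riemann_solution R).
Hypothesis left_front_cvg :
  locally_bounded_cvg (fun n => left_front (S n)) (left_front S0).
Hypothesis right_front_cvg :
  locally_bounded_cvg (fun n => right_front (S n)) (right_front S0).
Hypothesis left_cvg : locally_bounded_cvg
  (fun n t => ac (left_state (S n) t)) (fun t => ac (left_state S0 t)).
Hypothesis middle_cvg : locally_bounded_cvg
  (fun n t => ac (middle_state (S n) t)) (fun t => ac (middle_state S0 t)).
Hypothesis right_cvg : locally_bounded_cvg
  (fun n t => ac (right_state (S n) t)) (fun t => ac (right_state S0 t)).
Hypothesis sing_cvg : locally_bounded_cvg
  (fun n t => sing (middle_state (S n) t)) (fun t => sing (middle_state S0 t)).

Let ac_at (Z : riemann_solution R) x t : ac (state_at Z x t) =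
  if x < left_front Z t then ac (left_state Z t)
  else if right_front Z t < x then ac (right_state Z t)
  else ac (middle_state Z t).
Proof. by rewrite /state_at; case: ifP => // _; case: ifP. Qed.

Lemma ac_at_measurable (Z : riemann_solution R) :
  measurable_fun setT (left_front Z) -> measurable_fun setT (right_front Z) ->
  measurable_fun setT (fun t => ac (left_state Z t)) ->
  measurable_fun setT (fun t => ac (middle_state Z t)) ->
  measurable_fun setT (fun t => ac (right_state Z t)) ->
  measurable_fun setT (fun p : measurableTypeR R * measurableTypeR R =>
    ac (state_at Z p.1 p.2)).
Proof.
move=> ml mr mL mM mR; under eq_fun do rewrite ac_at.
have msnd (f : R -> R) : measurable_fun setT f ->
    measurable_fun setT (fun p : measurableTypeR R * measurableTypeR R => f p.2).
  by move=> mf; exact: (measurableT_comp mf measurable_snd).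
apply: measurable_fun_ifT; last apply: measurable_fun_ifT.
- by apply: measurable_fun_ltr; [exact: measurable_fst|exact: msnd].
- exact: (msnd (fun t => ac (left_state Z t))).
- by apply: measurable_fun_ltr; [exact: msnd|exact: measurable_fst].
- exact: (msnd (fun t => ac (right_state Z t))).
- exact: (msnd (fun t => ac (middle_state Z t))).
Qed.

Lemma ac_at_cvg x t : 0 <= t ->
  x != left_front S0 t -> x != right_front S0 t ->
  ac (state_at (S n) x t) @[n --> \oo] --> ac (state_at S0 x t).
Proof.
move=> t0 xl xr; under eq_fun do rewrite ac_at.
have [_ _ /(_ t t0) cl _] := left_front_cvg.
have [_ _ /(_ t t0) cr _] := right_front_cvg.
have [_ _ /(_ t t0) cL _] := left_cvg.
have [_ _ /(_ t t0) cM _] := middle_cvg.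
have [_ _ /(_ t t0) cR _] := right_cvg.
rewrite ac_at; case: (ltgtP x (left_front S0 t)) xl => // xl _.
  apply: cvg_trans cL; apply: near_eq_cvg; near=> n.
  by rewrite ifT//; near: n; exact: (cvgr_gt _ cl).
have lx : \forall n \near \oo, left_front (S n) t < x by exact: (cvgr_lt _ cl).
case: (ltgtP x (right_front S0 t)) xr => // xr _.
  apply: cvg_trans cM; apply: near_eq_cvg; near=> n.
  rewrite ifF; last by apply/negbTE; rewrite -leNgt ltW//; near: n.
  rewrite ifF//; apply/negbTE; rewrite -leNgt ltW//.
  by near: n; exact: (cvgr_gt _ cr).
apply: cvg_trans cR; apply: near_eq_cvg; near=> n.
rewrite ifF; last by apply/negbTE; rewrite -leNgt ltW//; near: n.
by rewrite ifT//; near: n; exact: (cvgr_lt _ cr).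
Unshelve. all: by end_near. Qed.

Lemma ac_at_bounded T : exists C, forall n x t, 0 <= t <= T ->
  `|ac (state_at (S n) x t)| <= C.
Proof.
have [_ _ _ /(_ T)[CL bL]] := left_cvg.
have [_ _ _ /(_ T)[CM bM]] := middle_cvg.
have [_ _ _ /(_ T)[CR bR]] := right_cvg.
exists (Num.max CL (Num.max CM CR)) => n x t tT; rewrite ac_at !le_max.
case: ifP => _; first by rewrite bL.
by case: ifP => _; [rewrite bR ?orbT|rewrite bM ?orbT].
Qed.

(** Dominated convergence in [x] for each fixed [t], then in [t]: the inner
    integrals are dominated by a multiple of the indicator of the window that
    contains the times of the support of [psi]. *)
Lemma half_plane_action_cvg psi : test_function psi ->
  half_plane_action ac sing (S n) psi @[n --> \oo]
    --> half_plane_action ac sing S0 psi.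
Proof.
move=> tpsi; have [K [M [M_ge0 psi_le]]] := test_function_dominated tpsi.
pose mu : {measure set (measurableTypeR R) -> \bar R} := lebesgue_measure.
pose w : R -> R := \1_`[- K, K].
have w_ge0 x : 0 <= w x by rewrite /w indicE.
have w_eq0 t : K < t -> w t = 0.
  move=> Kt; rewrite /w indicE memNset//= in_itv/= => /andP[_].
  by rewrite leNgt Kt.
have intw : mu.-integrable setT (EFin \o w).
  exact: (integrable_indic_itv (- K) K true false).
have intZw (D : set R) c : measurable D ->
    mu.-integrable D (EFin \o (fun x => c * w x)).
  move=> mD; apply: (@integrableS _ _ _ mu setT) => //.
  have -> : EFin \o (fun x => c * w x) = (fun x => c%:E * (w x)%:E)%E by [].
  exact: integrableZl.
have mpsi := continuous_prod_measurable tpsi.1.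
have mpsi_comp (f : R -> R) : measurable_fun setT f ->
    measurable_fun setT (fun t : measurableTypeR R => psi (f t, t)).
  move=> mf.
  have mft : measurable_fun setT (fun t : measurableTypeR R =>
    ((f t, t) : measurableTypeR R * measurableTypeR R)).
    by apply: measurable_fun_pair => //; exact: mf.
  exact: (measurableT_comp mpsi mft).
(* For [t] beyond [K] both sides vanish, so [a] needs a bound up to time [K] only. *)
have w_dom C a t x : (0 <= t <= K -> `|a| <= C) -> 0 <= t ->
    `|a * psi (x, t)| <= `|C| * M * w t * w x.
  move=> aC t0; have [tK|Kt] := leP t K.
    have -> : `|C| * M * w t * w x = `|C| * (M * (w x * w t)) by ring.
    rewrite normrM ler_pM// ?psi_le//.
    by rewrite (le_trans (aC _))// ?t0 ?tK// ler_norm.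
  have := psi_le x t; rewrite -/w (w_eq0 t Kt) !mulr0 normr_le0 => /eqP ->.
  by rewrite mulr0 normr0 mul0r.
have [mlf ml0 cl bl] := left_front_cvg; have [mrf mr0 cr br] := right_front_cvg.
have [mL mL0 cL bL] := left_cvg; have [mM mM0 cM bM] := middle_cvg.
have [mR mR0 cR bR] := right_cvg; have [ms ms0 cs bs] := sing_cvg.
pose F Z (p : measurableTypeR R * measurableTypeR R) : R :=
  ac (state_at Z p.1 p.2) * psi p.
have mF n : measurable_fun setT (F (S n)).
  by apply: measurable_funM => //; exact: ac_at_measurable.
have mF0 : measurable_fun setT (F S0).
  by apply: measurable_funM => //; exact: ac_at_measurable.
have mFt Z t : measurable_fun setT (F Z) ->
    measurable_fun setT (fun x : measurableTypeR R => F Z (x, t)).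
  by move=> mZ; exact: measurableT_comp mZ (pair2_measurable t).
have [C FC] := ac_at_bounded K.
have F_le n x t : 0 <= t -> `|F (S n) (x, t)| <= `|C| * M * w t * w x.
  by move=> t0; apply: (w_dom C) => // tK; exact: FC.
apply: cvgD.
- apply: (Rintegral_dominated_cvg (mu := mu)
    (g := fun t => (`|C| * M * \int[mu]_x w x) * w t)).
  + exact: measurable_itv.
  + move=> n; apply: measurable_funTS.
    exact: (measurable_Rintegral_section mu (mF n)).
  + by apply: measurable_funTS; exact: (measurable_Rintegral_section mu mF0).
  + apply: aeW => t; rewrite /= in_itv/= andbT => t0.
    apply: (Rintegral_dominated_cvg (mu := mu)
      (g := fun x => `|C| * M * w t * w x)) => //.
    * by move=> n; exact: (mFt (S n) t).
    * exact: (mFt S0 t).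
    * have [A [mA A0 ltA]] :=
        ae_off_two_points (left_front S0 t) (right_front S0 t).
      exists A; split=> // x /= ncv; apply: ltA => -[xl xr]; apply: ncv => _.
      by apply: cvgM; [exact: ac_at_cvg|exact: cvg_cst].
    * exact: intZw.
    * by move=> n x _; exact: F_le.
  + by apply: intZw; exact: measurable_itv.
  + move=> n t; rewrite /= in_itv/= andbT => t0.
    have iF : mu.-integrable setT (EFin \o (fun x => F (S n) (x, t))).
      apply: (@le_integrable _ _ _ mu setT _ _
        (EFin \o (fun x => `|C| * M * w t * w x))) => //.
      * by apply/measurable_EFinP; exact: mFt.
      * move=> x _ /=; rewrite lee_fin; apply: le_trans (F_le _ _ _ t0) _.
        exact: ler_norm.
      * exact: intZw.
    apply: le_trans (le_normr_Rintegral _ iF) _ => //.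
    rewrite [leRHS](_ : _ = \int[mu]_x (`|C| * M * w t * w x)).
      apply: le_Rintegral => //; [exact: integrable_norm|exact: intZw|].
      by move=> x _; exact: F_le.
    by rewrite mulrAC -RintegralZl.
have [D sD] := bs K.
apply: (Rintegral_dominated_cvg (mu := mu) (g := fun t => `|D| * M * w t)).
- exact: measurable_itv.
- move=> n; apply: measurable_funTS; apply: measurable_funM.
    exact: (ms n).
  exact: (mpsi_comp _ (mlf n)).
- apply: measurable_funTS; apply: measurable_funM.
    exact: ms0.
  exact: (mpsi_comp _ ml0).
- apply: aeW => t; rewrite /= in_itv/= andbT => t0.
  apply: cvgM; first exact: cs.
  have cfront : (left_front (S n) t, t) @[n --> \oo] --> (left_front S0 t, t).
    exact: (cvg_pair (F := \oo) (cl t t0) (cvg_cst t)).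
  exact: (cvg_comp _ _ cfront (tpsi.1 _)).
- by apply: intZw; exact: measurable_itv.
- move=> n t; rewrite /= in_itv/= andbT => t0.
  apply: le_trans (w_dom D _ _ _ _ t0) _ => //; first by move=> tK; exact: sD.
  rewrite ler_piMr//; last by rewrite /w indicE; case: (_ \in _).
  by rewrite !mulr_ge0.
Qed.

End half_plane.

(** * Convergence of waves with two fronts *)

Lemma locally_bounded_cvg_velocity (R : realType) (beta : R) (v : nat -> R) v0 :
  v n @[n --> \oo] --> v0 ->
  locally_bounded_cvg (fun n t => v n + beta * t) (fun t => v0 + beta * t).
Proof.
move=> vv; apply: locally_bounded_cvgD; first exact: locally_bounded_cvg_cst.
apply: locally_bounded_cvgM; last exact: locally_bounded_cvg_id.
by apply: locally_bounded_cvg_cst; exact: cvg_cst.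
Qed.

Lemma locally_bounded_cvg_char_curve (R : realType) (beta : R) (v : nat -> R) v0 :
  v n @[n --> \oo] --> v0 ->
  locally_bounded_cvg (fun n => char_curve beta (v n)) (char_curve beta v0).
Proof.
move=> vv.
have cst c : locally_bounded_cvg (fun _ _ => c) (fun=> c : R).
  by apply: locally_bounded_cvg_cst; exact: cvg_cst.
apply: locally_bounded_cvgD.
  apply: locally_bounded_cvgM (locally_bounded_cvg_id).
  exact: locally_bounded_cvg_cst.
apply: locally_bounded_cvgM (cst _).
by apply: locally_bounded_cvgM (cst _) _; do 2?apply: locally_bounded_cvgM;
  exact: locally_bounded_cvg_id.
Qed.

Section state_convergence.
Context {R : realType}.

Lemma near_eq_state_cvg (s s' : R -> state R) s0 :
  (\forall A \near 0^'+, s A = s' A) -> state_cvg s' s0 -> state_cvg s s0.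
Proof.
move=> ss'; case: s0 => [[nd d0]|rho0 u0 [rho [u [e cr cu]]]|w0 u0 [w [u [e cw cu]]]].
- split; first by apply: filterS2 ss' nd => A ->.
  apply: cvg_trans d0; apply: near_eq_cvg.
  by apply: filterS ss' => A ->.
- by exists rho, u; split=> //; apply: filterS2 ss' e => A ->.
- by exists w, u; split=> //; apply: filterS2 ss' e => A ->.
Qed.

Lemma fluid_state_cvg (rho v : R -> R) rho0 v0 beta t :
  rho A @[A --> 0^'+] --> rho0 -> v A @[A --> 0^'+] --> v0 ->
  state_cvg (fun A => fluid_state beta (rho A) (v A) t)
    (fluid_state beta rho0 v0 t).
Proof.
move=> cr cv; exists rho, (fun A => v A + beta * t); split => //.
  exact: nearW.
by apply: cvgD => //; exact: cvg_cst.
Qed.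

Lemma near_eq_riemann_cvg (S S' : R -> riemann_solution R) S0 :
  (\forall A \near 0^'+, S A = S' A) -> riemann_cvg S' S0 -> riemann_cvg S S0.
Proof.
move=> SS' [fr st ac]; have eqc (f : riemann_solution R -> R) (l : R) :
    f (S' A) @[A --> 0^'+] --> l -> f (S A) @[A --> 0^'+] --> l.
  apply: cvg_trans; apply: near_eq_cvg; by apply: filterS SS' => A ->.
split=> [t t0|x t t0 xl xr|psi tpsi].
- have [cl cr cm] := fr t t0; split.
  + exact: (eqc (fun Z => left_front Z t)).
  + exact: (eqc (fun Z => right_front Z t)).
  + by apply: near_eq_state_cvg cm; apply: filterS SS' => A ->.
- apply: near_eq_state_cvg (st x t t0 xl xr).
  by apply: filterS SS' => A ->.
- have [cd cm] := ac psi tpsi; split.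
  + exact: (eqc (fun Z => density_action Z psi)).
  + exact: (eqc (fun Z => momentum_action Z psi)).
Qed.

End state_convergence.

Section waves.
Context {R : realType}.
Variables (beta rhom um rhop up : R).

Definition two_front_wave (a b : R) (M : R -> state R) : riemann_solution R :=
  RiemannSolution (char_curve beta a) (char_curve beta b)
    (fluid_state beta rhom um) M (fluid_state beta rhop up).

(** Pointwise convergence alone would say nothing about the momentum of a middle
    state whose limit is a vacuum, nor about bounds uniform in the parameter;
    the second half supplies both, along sequences because the dominated
    convergence theorem is about sequences. *)
Definition middle_state_cvg (M : R -> R -> state R) (M0 : R -> state R) : Prop :=
  (forall t, 0 <= t -> state_cvg (fun A => M A t) (M0 t)) /\
  forall A_ : nat -> R, (forall n, 0 < A_ n) -> A_ n @[n --> \oo] --> 0 ->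
  forall ac, ac = @density R \/ ac = @momentum R \/
             ac = @dirac_density R \/ ac = @dirac_momentum R ->
  locally_bounded_cvg (fun n t => ac (M (A_ n) t)) (fun t => ac (M0 t)).

Lemma two_front_wave_cvg (a b : R -> R) (a0 b0 : R) M M0 :
  a A @[A --> 0^'+] --> a0 -> b A @[A --> 0^'+] --> b0 ->
  middle_state_cvg M M0 ->
  riemann_cvg (fun A => two_front_wave (a A) (b A) (M A)) (two_front_wave a0 b0 M0).
Proof.
move=> ca cb [sM lM].
have cc (v : R -> R) v0 t : v A @[A --> 0^'+] --> v0 ->
    char_curve beta (v A) t @[A --> 0^'+] --> char_curve beta v0 t.
  by move=> cv; apply: cvgD; [apply: cvgMr_tmp|exact: cvg_cst].
split=> [t t0|x t t0 /= xl xr|psi tpsi].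
- split=> /=; [exact: cc|exact: cc|exact: sM].
- have {}ca := cc _ _ t ca; have {}cb := cc _ _ t cb.
  rewrite {2}/state_at/=; case: (ltgtP x (char_curve beta a0 t)) xl => // xl _.
    apply: (@near_eq_state_cvg _ _ (fun=> fluid_state beta rhom um t)).
      by near=> A; rewrite /state_at/= ifT//; near: A; exact: (cvgr_gt _ ca).
    by apply: fluid_state_cvg; exact: cvg_cst.
  have lx : \forall A \near 0^'+, char_curve beta (a A) t < x.
    exact: (cvgr_lt _ ca).
  case: (ltgtP x (char_curve beta b0 t)) xr => // xr _.
    apply: near_eq_state_cvg (sM t t0); near=> A; rewrite /state_at/=.
    rewrite ifF; last by apply/negbTE; rewrite -leNgt ltW//; near: A.
    rewrite ifF//; apply/negbTE; rewrite -leNgt ltW//.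
    by near: A; exact: (cvgr_gt _ cb).
  apply: (@near_eq_state_cvg _ _ (fun=> fluid_state beta rhop up t)).
    near=> A; rewrite /state_at/=.
    rewrite ifF; last by apply/negbTE; rewrite -leNgt ltW//; near: A.
    by rewrite ifT//; near: A; exact: (cvgr_lt _ cb).
  by apply: fluid_state_cvg; exact: cvg_cst.
- have cst c : locally_bounded_cvg (fun _ _ => c) (fun=> c : R).
    by apply: locally_bounded_cvg_cst; exact: cvg_cst.
  have vel v : locally_bounded_cvg (fun _ t => v + beta * t) (fun t => v + beta * t).
    by apply: locally_bounded_cvg_velocity; exact: cvg_cst.
  split; apply/cvg_at_rightP => A_ [A_gt0 A_cvg];
    have la := (cvg_at_rightP _ _ _).1 ca A_ (conj A_gt0 A_cvg);
    have lb := (cvg_at_rightP _ _ _).1 cb A_ (conj A_gt0 A_cvg);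
    have {}lM := lM A_ A_gt0 A_cvg.
  + apply: (half_plane_action_cvg
      (S := fun n => two_front_wave (a (A_ n)) (b (A_ n)) (M (A_ n)))) => //=.
    * exact: locally_bounded_cvg_char_curve.
    * exact: locally_bounded_cvg_char_curve.
    * by apply: lM; left.
    * by apply: lM; right; right; left.
  + apply: (half_plane_action_cvg
      (S := fun n => two_front_wave (a (A_ n)) (b (A_ n)) (M (A_ n)))) => //=.
    * exact: locally_bounded_cvg_char_curve.
    * exact: locally_bounded_cvg_char_curve.
    * exact: locally_bounded_cvgM.
    * by apply: lM; right; left.
    * exact: locally_bounded_cvgM.
    * by apply: lM; right; right; right.
Unshelve. all: by end_near. Qed.

Lemma fluid_middle_cvg (rho : R -> R) rho0 v :
  rho A @[A --> 0^'+] --> rho0 ->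
  middle_state_cvg (fun A => fluid_state beta (rho A) v) (fluid_state beta rho0 v).
Proof.
move=> cr; split=> [t t0|A_ A_gt0 A_cvg].
  by apply: fluid_state_cvg => //; exact: cvg_cst.
have lr := (cvg_at_rightP _ _ _).1 cr A_ (conj A_gt0 A_cvg).
have cst : locally_bounded_cvg (fun _ _ => 0) (fun=> 0 : R).
  by apply: locally_bounded_cvg_cst; exact: cvg_cst.
move=> _ [->|[->|[->|->]]] //=; first exact: locally_bounded_cvg_cst.
apply: locally_bounded_cvgM; first exact: locally_bounded_cvg_cst.
by apply: locally_bounded_cvg_velocity; exact: cvg_cst.
Qed.

(** A fluid of vanishing density has vanishing momentum as its velocity is fixed:
    for the two actions, a vacuum is a fluid of density 0. *)
Lemma vacuum_middle_cvg (rho : R -> R) v :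
  rho A @[A --> 0^'+] --> 0 ->
  middle_state_cvg (fun A => fluid_state beta (rho A) v) (fun=> Vacuum).
Proof.
move=> cr; split=> [t t0|A_ A_gt0 A_cvg].
  by split=> //; exact: nearW.
have [_ lM] := fluid_middle_cvg v cr.
move=> ac hac; have := lM A_ A_gt0 A_cvg ac hac.
congr (locally_bounded_cvg _ _); apply/funext => t.
by case: hac => [->|[->|[->|->]]] //=; rewrite mul0r.
Qed.

Lemma delta_shock_middle_cvg (w v : R -> R) (w0 v0 : R) :
  w A @[A --> 0^'+] --> w0 -> v A @[A --> 0^'+] --> v0 ->
  middle_state_cvg (fun A t => DeltaShock (w A * t) (v A + beta * t))
    (fun t => DeltaShock (w0 * t) (v0 + beta * t)).
Proof.
move=> cw cv; split=> [t t0|A_ A_gt0 A_cvg].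
  exists (fun A => w A * t), (fun A => v A + beta * t); split.
  - exact: nearW.
  - exact: cvgMr_tmp.
  - by apply: cvgD => //; exact: cvg_cst.
have lw := (cvg_at_rightP _ _ _).1 cw A_ (conj A_gt0 A_cvg).
have lv := (cvg_at_rightP _ _ _).1 cv A_ (conj A_gt0 A_cvg).
have cst : locally_bounded_cvg (fun _ _ => 0) (fun=> 0 : R).
  by apply: locally_bounded_cvg_cst; exact: cvg_cst.
have lwt : locally_bounded_cvg (fun n t => w (A_ n) * t) (fun t => w0 * t).
  apply: locally_bounded_cvgM; first exact: locally_bounded_cvg_cst.
  exact: locally_bounded_cvg_id.
move=> _ [->|[->|[->|->]]] //=.
by apply: locally_bounded_cvgM => //; exact: locally_bounded_cvg_velocity.
Qed.

End waves.

(** * The limits of the wave parameters *)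

Lemma pressure_cvg0 (R : realType) (r : R) : A / r @[A --> 0^'+] --> 0.
Proof.
rewrite -[X in _ --> X](mul0r r^-1).
by apply: cvgMr_tmp; apply: cvg_at_right_filter; exact: cvg_id.
Qed.

Section vanishing_pressure.
Context {R : realType}.
Variables (rhom um rhop up : R).
Hypotheses (rhom_gt0 : 0 < rhom) (rhop_gt0 : 0 < rhop).

Lemma rho_star_cvg0 : um < up -> rho_star rhom um up A @[A --> 0^'+] --> 0.
Proof.
move=> umup; have d0 : up - um + 0 != 0 by rewrite addr0 subr_eq0 gt_eqF.
rewrite -[X in _ --> X](mul0r (up - um + 0)^-1).
apply: cvgM; first by apply: cvg_at_right_filter; exact: cvg_id.
by apply: cvgV => //; apply: cvgD; [exact: cvg_cst|exact: pressure_cvg0].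
Qed.

Lemma chaplygin_w0_cvg : up < um ->
  chaplygin_w0 rhom um rhop up A @[A --> 0^'+] --> transport_w0 rhom um rhop up.
Proof.
move=> upum; rewrite /chaplygin_w0 /transport_w0; case: eqVneq => [->|_].
  by rewrite -mulrBr; exact: cvg_cst.
have -> : Num.sqrt (rhop * rhom) * (um - up) =
    Num.sqrt (rhop * rhom * (up - um) * ((up - um) - (0 - 0))).
  rewrite !subr0 -[rhop * rhom * _ * _]mulrA [RHS]sqrtrM; last first.
    by rewrite mulr_ge0 ?ltW.
  by rewrite -expr2 sqrtr_sqr distrC gtr0_norm ?subr_gt0.
have gap_cvg : (up - um) - (A / rhop - A / rhom) @[A --> 0^'+] -->
    (up - um) - (0 - 0).
  by apply: cvgB; [exact: cvg_cst|apply: cvgB; exact: pressure_cvg0].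
have arg_cvg : rhop * rhom * (up - um) * ((up - um) - (A / rhop - A / rhom))
    @[A --> 0^'+] --> rhop * rhom * (up - um) * ((up - um) - (0 - 0)).
  exact: cvgMl_tmp.
exact: (cvg_comp _ _ arg_cvg (@sqrt_continuous R _)).
Qed.

Lemma chaplygin_vdelta_cvg : up < um ->
  chaplygin_vdelta rhom um rhop up A @[A --> 0^'+]
    --> transport_vdelta rhom um rhop up.
Proof.
move=> upum; rewrite /chaplygin_vdelta.
have := chaplygin_w0_cvg upum; rewrite /transport_vdelta /transport_w0.
case: eqVneq => [_ _|rpm cw].
  have -> : (up + um) / 2 = (up + um - 0) / 2 by rewrite subr0.
  apply: cvgMr_tmp; apply: cvgB.
    exact: cvg_cst.
  exact: pressure_cvg0.
suff -> : (Num.sqrt rhom * um + Num.sqrt rhop * up) /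
    (Num.sqrt rhom + Num.sqrt rhop) =
    (rhop * up - rhom * um + Num.sqrt (rhop * rhom) * (um - up)) / (rhop - rhom).
  by apply: cvgMr_tmp; apply: cvgD => //; exact: cvg_cst.
(* In terms of [m = sqrt rhom] and [p = sqrt rhop] the identity is rational. *)
have [em ep] := (sqr_sqrtr (ltW rhom_gt0), sqr_sqrtr (ltW rhop_gt0)).
have m_gt0 : 0 < Num.sqrt rhom by rewrite sqrtr_gt0.
have p_gt0 : 0 < Num.sqrt rhop by rewrite sqrtr_gt0.
rewrite sqrtrM ?ltW//.
move: (Num.sqrt rhom) (Num.sqrt rhop) em ep m_gt0 p_gt0 => m p em ep m_gt0 p_gt0.
move: rpm; rewrite -em -ep -subr_eq0 => p2m2.
by field; rewrite p2m2 gt_eqF ?addr_gt0.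
Qed.

End vanishing_pressure.

(** * The vanishing pressure limit *)

Theorem theorem4p3 (R : realType) (beta rhom um rhop up : R)
    (hrhom : 0 < rhom) (hrhop : 0 < rhop) (hum : 0 <= um) (hup : 0 <= up) :
  riemann_cvg (chaplygin_solution beta rhom um rhop up)
              (transport_solution beta rhom um rhop up)
  /\ (um < up -> forall x t : R, 0 < t ->
        char_curve beta um t < x -> x < char_curve beta up t ->
        state_at (transport_solution beta rhom um rhop up) x t = Vacuum)
  /\ (up < um -> forall t : R, 0 < t -> exists x w u : R,
        0 < w /\
        state_at (transport_solution beta rhom um rhop up) x t = DeltaShock w u).
Proof.
have contact : um <= up -> \forall A \near 0^'+,
    chaplygin_solution beta rhom um rhop up A =
    two_front_wave beta rhom um rhop up (um - A / rhom) up
      (fluid_state beta (rho_star rhom um up A) up).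
  move=> le_um_up; near=> A; rewrite /chaplygin_solution ifT//.
  by rewrite ltrBlDr ltr_pwDr// divr_gt0.
have left_cvg : um - A / rhom @[A --> 0^'+] --> um.
  rewrite -[X in _ --> X]subr0.
  by apply: cvgB; [exact: cvg_cst|exact: pressure_cvg0].
split; last split.
- rewrite /transport_solution; case: ltgtP => [lt_um_up|lt_up_um|eq_um_up].
  + apply: near_eq_riemann_cvg (contact (ltW lt_um_up)) _.
    apply: two_front_wave_cvg => //; first exact: cvg_cst.
    by apply: vacuum_middle_cvg; exact: rho_star_cvg0.
  + apply: (@near_eq_riemann_cvg _ _ (fun A => delta_wave beta rhom um rhop up
      (chaplygin_vdelta rhom um rhop up A) (chaplygin_w0 rhom um rhop up A))).
      near=> A; rewrite /chaplygin_solution ifF//; apply/negbTE.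
      by rewrite -leNgt ltW//; near: A; exact: (cvgr_gt _ left_cvg).
    have v_cvg := chaplygin_vdelta_cvg hrhom hrhop lt_up_um.
    apply: (two_front_wave_cvg _ _ _ _ _ v_cvg v_cvg).
    apply: delta_shock_middle_cvg => //; exact: chaplygin_w0_cvg.
  + apply: near_eq_riemann_cvg (contact _) _; first by rewrite eq_um_up.
    apply: two_front_wave_cvg => //; first exact: cvg_cst.
    have -> : fluid_state beta rhom um = fluid_state beta rhom up by rewrite eq_um_up.
    apply: fluid_middle_cvg.
    (* For equal velocities [A / (0 + A / rhom) = rhom]. *)
    have rho_starE : \forall A \near 0^'+, rhom = rho_star rhom um up A.
      near=> A; rewrite /rho_star eq_um_up subrr add0r invf_div mulrC divfK//.
    by apply: cvg_trans (near_eq_cvg rho_starE) _; exact: cvg_cst.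
- move=> um_up x t t0 lx xr.
  by rewrite /transport_solution um_up /state_at/= ifF ?ifF//; apply/negbTE;
    rewrite -leNgt ltW.
- move=> up_um t t0; set v := transport_vdelta rhom um rhop up.
  exists (char_curve beta v t), (transport_w0 rhom um rhop up * t), (v + beta * t).
  rewrite mulr_gt0//; last first.
    by rewrite /transport_w0; case: ifP => _;
      rewrite mulr_gt0 ?sqrtr_gt0 ?mulr_gt0 ?subr_gt0.
  split=> //; rewrite /transport_solution ltNge (ltW up_um)/= gt_eqF//.
  by rewrite /state_at/= ltxx.
Unshelve. all: by end_near. Qed.
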